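(* Let $n\ge1$. (1) $\xi_{2n+1}\equiv\mathsf{slang}_1(\mathsf{sa}_{2n+1})\bmod \mathsf{ARI}_{\ge4}$. Consequently \[ \sigma^c_{2n+1}-\mathsf{luma}_{2n+1}\equiv\sum_{\substack{a+b=n\\ a,b\ge1}}\frac{B_{2a}B_{2b}}{24\,b\,B_{2n}}\binom{2n}{2a}D_{a,b}\bmod\mathsf{ARI}_{\ge4}, \] where $D_{a,b}:=\mathsf{ari}(\mathsf{sa}_{2a+1},\mathsf{ari}(\mathsf{sa}_{2b+1},\mathsf{sa}_{-1}))+2b\,\mathsf{ari}(\mathsf{slang}_1(\mathsf{sa}_{2a+1}),\mathsf{slang}_2(\mathsf{sa}_{2b}))\in\mathsf{ARI}_{\ge3}$. (2) For each such $a,b$, the length-three component $D_{a,b}^{3}(x_1,x_2,x_3)$ lies in $\mathbb{Q}[x_1,x_2,x_3]$.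
   Context: Moulds: $M=(M^m(x_1,\dots,x_m))_{m\ge0}$ with $M^m\in\mathbb{Q}((x_1,\dots,x_m))$ (fraction field of $\mathbb{Q}[[x_1,\dots,x_m]]$); $M(\omega):=M^m(w_1,\dots,w_m)$ for a word $\omega=(w_1,\dots,w_m)$ of $\mathbb{Z}$-linear forms. Product $(M\times N)^m=\sum_{k}M^k(x_1,\dots,x_k)N^{m-k}(x_{k+1},\dots,x_m)$, unit $1$. $\mathsf{ARI}$: $M^0=0$; $\mathsf{ARI}_{\ge k}$: $M^m=0$ for $m<k$; $\mathsf{GARI}$: $M^0=1$. For an integer $s$, $\mathsf{sa}_s$ is the mould with $\mathsf{sa}_s^1(u)=u^{s-1}$ and $0$ in other lengths. $B_m$ are Bernoulli numbers, $\frac{x}{e^x-1}=\sum B_mx^m/m!$. Flexions: for nonempty $\alpha=(a_1,\dots,a_m)$, $\beta=(b_1,\dots,b_n)$: $\lceil\beta\rceil\alpha=(b_1+\cdots+b_n+a_1,a_2,\dots,a_m)$, $\alpha\lfloor\beta\rfloor=(a_1,\dots,a_{m-1},a_m+b_1+\cdots+b_n)$; $\lceil\emptyset\rceil\gamma=\gamma\lfloor\emptyset\rfloor=\gamma$, $\lceil\gamma\rceil\emptyset=\emptyset\lfloor\gamma\rfloor=\emptyset$; $\lceil a\rceil b\lfloor c\rfloor$ ($b\neq\emptyset$) is $b$ with first entry increased by the sum of $a$ and last entry by the sum of $c$. $\mathsf{arit}(N)(M)$: $0$ in lengths $0,1$; for $m\ge2$, $\sum_{\alpha\beta\gamma=(x_1..x_m),\beta,\gamma\ne\emptyset}M(\alpha\lceil\beta\rceil\gamma)N(\beta)-\sum_{\alpha\beta\gamma,\alpha,\beta\ne\emptyset}M(\alpha\lfloor\beta\rfloor\gamma)N(\beta)$.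 $\mathsf{preari}(M,N)=\mathsf{arit}(N)(M)+M\times N$, $\mathsf{ari}(M,N)=\mathsf{preari}(M,N)-\mathsf{preari}(N,M)$. $\mathsf{preari}_0(A)=1$, $\mathsf{preari}_n(A)=\mathsf{preari}(\mathsf{preari}_{n-1}(A),A)$ ($\mathsf{preari}_1(A)=A$), $\mathsf{expari}(A)=\sum_n\mathsf{preari}_n(A)/n!$, bijective $\mathsf{ARI}\to\mathsf{GARI}$ with inverse $\mathsf{logari}$. $\mathsf{garit}(T)(S)$: $1$ in length $0$; for $m\ge1$, $\sum_{s\ge1}\sum S(\lceil a_1\rceil b_1\lfloor c_1\rfloor\cdots\lceil a_s\rceil b_s\lfloor c_s\rfloor)T(a_1)\cdots T(a_s)T^{\times-1}(c_1)\cdots T^{\times-1}(c_s)$ over $(x_1,\dots,x_m)=a_1b_1c_1\cdots a_sb_sc_s$, $b_i\ne\emptyset$, $c_ia_{i+1}\ne\emptyset$ ($i<s$). $\mathsf{gari}(S,T)=\mathsf{garit}(T)(S)\times T$ (group law on $\mathsf{GARI}$, inverse $\mathsf{invgari}$). $\mathsf{adari}(S)(A)=\mathsf{logari}(\mathsf{gari}(\mathsf{gari}(S,\mathsf{expari}A),\mathsf{invgari}S))$; $\mathsf{adari}(S)^{-1}=\mathsf{adari}(\mathsf{invgari}S)$. $\mathsf{neg}(M)^m(x_1..x_m)=M^m(-x_1,..,-x_m)$; $\mathsf{paj}^m=1/(x_1(x_1+x_2)\cdots(x_1+\cdots+x_m))$, $\mathsf{paj}^0=1$; $\mathsf{sang}(M)=\frac12(\mathrm{id}+\mathsf{neg}\circ\mathsf{adari}(\mathsf{paj}))(\mathsf{paj}^{\times-1}\times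 M\times\mathsf{paj})$. $\mathsf{dupal}^m=\frac{B_m}{m!}\frac{1}{x_1\cdots x_m}\sum_{k=0}^{m-1}(-1)^k\binom{m-1}{k}x_{k+1}$ ($m\ge1$), $\mathsf{dupal}^0=0$; $\mathsf{pal}\in\mathsf{GARI}$ is the unique mould with $(x_1+\cdots+x_m)\mathsf{pal}^m=(\mathsf{pal}\times\mathsf{dupal})^m$ for $m\ge1$. $\mathsf{leng}_r(M)^m=\delta_{m,r}M^m$. $\mathsf{slang}_r(A)=\mathsf{adari}(\mathsf{pal})\circ\mathsf{leng}_r\circ\mathsf{adari}(\mathsf{pal})^{-1}\circ\mathsf{sang}(A)$. $s'$ is the mould with $s'^1(u_1)=\frac1{2u_1}$, $s'^2(u_1,u_2)=\frac1{12}\big(\frac1{x_1x_2}+\frac1{x_2(x_1-x_2)}\big)$ where $x_1=u_1,x_2=u_1+u_2$, and $0$ in other lengths. For $S$ concentrated in length $1$, $\xi'(S)=S+\mathsf{ari}(S,s')+\frac12\mathsf{ari}(\mathsf{ari}(S,s'),s')$ mod $\mathsf{ARI}_{\ge4}$, and $\xi_{2n+1}=\xi'(\mathsf{sa}_{2n+1})$. Modulo $\mathsf{ARI}_{\ge4}$: $\sigma^c_{2n+1}\equiv\xi_{2n+1}+\sum_{a+b=n,\,a,b\ge1}\frac1{24b}\frac{B_{2a}B_{2b}}{B_{2n}}\binom{2n}{2a}\mathsf{ari}(\mathsf{sa}_{2a+1},\mathsf{ari}(\mathsf{sa}_{2b+1},\mathsf{sa}_{-1}))$ and $\mathsf{luma}_{2n+1}\equiv\mathsf{slang}_1(\mathsf{sa}_{2n+1})-\frac1{12}\sum_{a+b=n,\,a,b\ge1}\frac{B_{2a}B_{2b}}{B_{2n}}\binom{2n}{2a}\mathsf{ari}(\mathsf{slang}_1(\mathsf{sa}_{2a+1}),\mathsf{slang}_2(\mathsf{sa}_{2b}))$.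 *)

(* Defs.v *)
From HB Require Import structures.
From mathcomp Require Import all_boot all_order all_algebra.
From mathcomp Require Import mpoly.
From Stdlib Require Import ClassicalEpsilon.

Set Implicit Arguments.
Unset Strict Implicit.
Unset Printing Implicit Defensive.

Import Order.TTheory GRing.Theory Num.Theory.
Local Open Scope ring_scope.

(* Bernoulli numbers, convention x/(e^x-1) = sum B_m x^m/m!  (B_1 = -1/2):    *)
(*   B_0 = 1,  sum_{k=0}^{m} C(m+1,k) B_k = 0  for m >= 1.                    *)
Fixpoint bern_list (m : nat) : seq rat :=
  match m with
  | 0 => [:: 1]
  | m'.+1 =>
      let s := bern_list m' in
      rcons s (- (m'.+2%:R)^-1 *
               \sum_(k < m'.+1) 'C(m'.+2, k)%:R * nth 0 s k)
  end.

Definition bernoulli (m : nat) : rat := nth 0 (bern_list m) m.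

(* Moulds over a field K: a mould M is given by its values M(w) on words w   *)
(* (sequences of elements of K); M^m(x_1..x_m) = M [:: x_1; ..; x_m].        *)
Section Moulds.
Variable K : fieldType.

Definition mould := seq K -> K.

Definition madd (M N : mould) : mould := fun w => M w + N w.
Definition mopp (M : mould) : mould := fun w => - M w.
Definition msub (M N : mould) : mould := fun w => M w - N w.
Definition mscale (c : K) (M : mould) : mould := fun w => c * M w.
Definition mzero : mould := fun _ => 0.

Definition mone : mould := fun w => if w is [::] then 1 else 0.

Definition mmul (M N : mould) : mould :=
  fun w => \sum_(k < (size w).+1) M (take k w) * N (drop k w).

Definition wsum (w : seq K) : K := \sum_(x <- w) x.

Definition ceil (b a : seq K) : seq K :=
  if a is x :: a' then (wsum b + x) :: a' else [::].
Definition floor (a b : seq K) : seq K :=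
  if a is [::] then [::]
  else rcons (belast (head 0 a) (behead a)) (last 0 a + wsum b).
Definition flex (a b c : seq K) : seq K := ceil a (floor b c).

(* decomposition w = alpha beta gamma with alpha = take i w,
   beta = drop i (take j w), gamma = drop j w, for i <= j <= size w *)
Definition arit (N M : mould) : mould :=
  fun w =>
    if (size w < 2)%N then 0 else
    \sum_(i < (size w).+1) \sum_(j < (size w).+1)
      ((if ((i < j) && (j < size w))%N then
          M (take i w ++ ceil (drop i (take j w)) (drop j w))
            * N (drop i (take j w)) else 0)
       - (if ((0 < i) && (i < j))%N then
          M (floor (take i w) (drop i (take j w)) ++ drop j w)
            * N (drop i (take j w)) else 0)).

Definition preari (M N : mould) : mould := madd (arit N M) (mmul M N).
Definition ari (M N : mould) : mould := msub (preari M N) (preari N M).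

Fixpoint preari_n (A : mould) (n : nat) : mould :=
  match n with
  | 0 => mone
  | n'.+1 => preari (preari_n A n') A
  end.

(* expari A = sum_n preari_n(A)/n!; for A in ARI, preari_n(A) vanishes in
   lengths < n, so in length m only the terms n <= m contribute. *)
Definition expari (A : mould) : mould :=
  fun w => \sum_(n < (size w).+1) preari_n A n w / (n`!)%:R.

Definition is_ARI (A : mould) : Prop := A [::] = 0.
Definition is_GARI (S : mould) : Prop := S [::] = 1.

Lemma inhabited_mould : inhabited mould.
Proof. exact: inhabits mzero. Qed.

Definition logari (S : mould) : mould :=
  epsilon inhabited_mould (fun A => is_ARI A /\ expari A = S).

Definition minv (T : mould) : mould :=
  epsilon inhabited_mould (fun U => mmul T U = mone).

Fixpoint cuts (n : nat) (w : seq K) : seq (seq (seq K)) :=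
  match n with
  | 0 => if w is [::] then [:: [::]] else [::]
  | n'.+1 => flatten [seq [seq take k w :: p | p <- cuts n' (drop k w)]
                     | k <- iota 0 (size w).+1]
  end.

(* garit(T)(S): sum over s >= 1 and w = a_1 b_1 c_1 ... a_s b_s c_s with
   b_i nonempty and c_i a_(i+1) nonempty (i < s) *)
Definition garit (T S : mould) : mould :=
  fun w =>
    if w is [::] then 1 else
    let Ti := minv T in
    \sum_(1 <= s < (size w).+1)
      \sum_(p <- cuts (3 * s) w)
        let a i := nth [::] p (3 * i) in
        let b i := nth [::] p (3 * i).+1 in
        let c i := nth [::] p (3 * i).+2 in
        if [forall i : 'I_s, b i != [::]] &&
           [forall i : 'I_s, ((i.+1 < s)%N ==> (c i ++ a i.+1 != [::]))]
        then S (flatten [seq flex (a i) (b i) (c i) | i <- iota 0 s])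
             * \prod_(i < s) (T (a i) * Ti (c i))
        else 0.

Definition gari (S T : mould) : mould := mmul (garit T S) T.

Definition invgari (S : mould) : mould :=
  epsilon inhabited_mould (fun T => is_GARI T /\ gari S T = mone).

Definition adari (S : mould) (A : mould) : mould :=
  logari (gari (gari S (expari A)) (invgari S)).

Definition neg (M : mould) : mould := fun w => M (map (fun x => - x) w).

Definition paj : mould :=
  fun w => \prod_(k < size w) (wsum (take k.+1 w))^-1.

Definition sang (M : mould) : mould :=
  let N := mmul (mmul (minv paj) M) paj in
  mscale (2^-1) (madd N (neg (adari paj N))).

Definition dupal : mould :=
  fun w =>
    if w is [::] then 0 else
    let m := size w in
    ratr (bernoulli m / (m`!)%:R) * (\prod_(x <- w) x)^-1
      * \sum_(k < m) (-1) ^+ k * ('C(m.-1, k))%:R * nth 0 w k.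

(* pal: pal^0 = 1 and (x_1+...+x_m) pal^m = (pal x dupal)^m for m >= 1;
   since dupal^0 = 0 this determines pal^m recursively:
   pal^m = (x_1+..+x_m)^{-1} sum_{k<m} pal^k(x_1..x_k) dupal^{m-k}(...) *)
Fixpoint pal_rec (fuel : nat) (w : seq K) : K :=
  match fuel with
  | 0 => 1
  | f'.+1 =>
      if w is [::] then 1 else
      (wsum w)^-1 *
        \sum_(k < size w) pal_rec f' (take k w) * dupal (drop k w)
  end.

Definition pal : mould := fun w => pal_rec (size w) w.

Definition leng (r : nat) (M : mould) : mould :=
  fun w => if size w == r then M w else 0.

Definition slang (r : nat) (A : mould) : mould :=
  adari pal (leng r (adari (invgari pal) (sang A))).

Definition sa (s : int) : mould :=
  fun w => if w is [:: u] then u ^ (s - 1) else 0.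

Definition s' : mould :=
  fun w => match w with
  | [:: u1] => (2 * u1)^-1
  | [:: u1; u2] =>
      let x1 := u1 in let x2 := u1 + u2 in
      12^-1 * ((x1 * x2)^-1 + (x2 * (x1 - x2))^-1)
  | _ => 0
  end.

(* xi'(S) mod ARI_{>=4} *)
Definition xi' (S : mould) : mould :=
  madd S (madd (ari S s') (mscale (2^-1) (ari (ari S s') s'))).

End Moulds.

Arguments sa : clear implicits.

(* Ambient field: rational functions Q(x_1,x_2,x_3).  Lengths <= 3 suffice  *)
(* for congruences modulo ARI_{>=4}.                                        *)
Definition RF : fieldType := {fraction {mpoly rat[3]}}.

Definition var (i : 'I_3) : RF := FracField.tofrac ('X_i : {mpoly rat[3]}).

Definition vars (m : nat) : seq RF :=
  map var (filter (fun i : 'I_3 => (nat_of_ord i < m)%N) (enum 'I_3)).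

Definition congr4 (M N : mould RF) : Prop :=
  forall m : nat, (m <= 3)%N -> M (vars m) = N (vars m).

Definition in_ARI_ge (k : nat) (M : mould RF) : Prop :=
  forall m : nat, (m < k)%N -> M (vars m) = 0.

Definition xi (n : nat) : mould RF := xi' (sa RF (2 * n + 1)%N).

Definition Dab (a b : nat) : mould RF :=
  madd (ari (sa RF (2 * a + 1)%N) (ari (sa RF (2 * b + 1)%N) (sa RF (-1))))
       (mscale (2 * b)%:R (ari (slang 1 (sa RF (2 * a + 1)%N))
                               (slang 2 (sa RF (2 * b)%N)))).

Definition msum (I : Type) (r : seq I) (F : I -> mould RF) : mould RF :=
  fun w => \sum_(i <- r) F i w.

Definition bcoef (n a : nat) : rat :=
  bernoulli (2 * a) * bernoulli (2 * (n - a)) / bernoulli (2 * n)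
    * ('C(2 * n, 2 * a))%:R.

(* right-hand side of the congruence for sigma^c_{2n+1} *)
Definition sigma_formula (n : nat) : mould RF :=
  madd (xi n)
    (msum (iota 1 n.-1) (fun a =>
       mscale (ratr ((24 * (n - a))%:R^-1 * bcoef n a))
         (ari (sa RF (2 * a + 1)%N)
              (ari (sa RF (2 * (n - a) + 1)%N) (sa RF (-1)))))).

(* right-hand side of the congruence for luma_{2n+1} *)
Definition luma_formula (n : nat) : mould RF :=
  msub (slang 1 (sa RF (2 * n + 1)%N))
    (msum (iota 1 n.-1) (fun a =>
       mscale (ratr (12%:R^-1 * bcoef n a))
         (ari (slang 1 (sa RF (2 * a + 1)%N))
              (slang 2 (sa RF (2 * (n - a))%N))))).

Definition diff_formula (n : nat) : mould RF :=
  msum (iota 1 n.-1) (fun a =>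
    mscale (ratr ((24 * (n - a))%:R^-1 * bcoef n a)) (Dab a (n - a))).

(* Main.v *)
(** In lengths at most 3 every operation is an explicit polynomial in the values
    of the moulds at the contiguous partial sums of the word. Each operator
    defined by choice ([minv], [logari], [invgari]) inverts a map that is
    triangular for the length filtration, hence its defining equation holds and
    determines its values recursively.

    (1) [pal] agrees with [expari (- s')] in lengths at most 2, and the
    length-3 component of [pal] cancels in [adari pal A] when [A] is
    concentrated in length 1; so [adari pal A] is the exponential series
    [xi' A]. Since [sang] fixes even functions of one variable,
    [slang 1 (sa (2n+1)) = adari pal (sa (2n+1))].

    (2) [sang (sa 2b)] vanishes in length 1, so [slang 2 (sa 2b)] equals
    [sang (sa 2b)] in length 2 and
    [D_{a,b} = ari (sa (2a+1)) E] in length 3 with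
    [E = ari (sa (2b+1)) (sa (-1)) + 2b sang (sa 2b)]. The poles of [E(u,v)]
    along [u], [v] and [u+v] cancel, by the expansion of [(x+y)^(2b)] modulo
    [x^2]. *)

Require Import Defs.
From HB Require Import structures.
From mathcomp Require Import all_boot all_order all_algebra.
From mathcomp Require Import mpoly.
From mathcomp Require Import zify ring.
From Stdlib Require Import ClassicalEpsilon FunctionalExtensionality.

Set Implicit Arguments.
Unset Strict Implicit.
Unset Printing Implicit Defensive.

Import GRing.Theory.
Local Open Scope ring_scope.

Section Moulds.
Variable K : fieldType.
Implicit Types (x y z : K) (w : seq K) (M N S T A : mould K).

Lemma wsum0 : wsum [::] = 0 :> K. Proof. by rewrite /wsum big_nil. Qed.
Lemma wsum1 x : wsum [:: x] = x. Proof. by rewrite /wsum big_seq1. Qed.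
Lemma wsum2 x y : wsum [:: x; y] = x + y. Proof. by rewrite /wsum !big_cons big_nil addr0. Qed.
Lemma wsum3 x y z : wsum [:: x; y; z] = x + y + z.
Proof. by rewrite /wsum !big_cons big_nil addr0 addrA. Qed.
Definition wsumE := (wsum0, wsum1, wsum2, wsum3).

(** * Existence of inverses by triangularity *)

Lemma size_ceil v w : size (ceil v w) = size w.
Proof. by case: w. Qed.

Lemma size_floor v w : size (floor w v) = size w.
Proof. by case: w => // x w; rewrite /= size_rcons size_belast. Qed.

(** [F M w - M w] only sees shorter words, so [M w = S w - (F M w - M w)] is a recursion on length.
    It is solved by iterating [G]: the value at [w] is stationary after more than [size w] steps. *)
Lemma triangular_surj (F : mould K -> mould K) (c : K) S :
    (forall M, M [::] = c -> F M [::] = S [::]) ->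
    (forall M N w, M [::] = c -> N [::] = c -> w != [::] ->
       (forall v, (size v < size w)%N -> M v = N v) ->
       F M w - M w = F N w - N w) ->
  exists M, M [::] = c /\ F M = S.
Proof.
move=> F0 Ftri.
pose G M : mould K := fun w => if w is [::] then c else S w - (F M w - M w).
pose X k := iter k G (fun=> c).
have X0 k : X k [::] = c by rewrite /X; case: k => [|k] //; rewrite iterS.
have Xstable k l w : (size w < k)%N -> (size w < l)%N -> X k w = X l w.
  elim: k l w => [|k IH] [|l] [|x w] // ltk ltl; rewrite /X !iterS /G.
  congr (_ - _); apply: Ftri; rewrite -/(X _) ?X0 // => v ltv; apply: IH;
    exact: leq_trans ltv _.
pose M : mould K := fun w => X (size w).+1 w.
exists M; split=> //; apply: functional_extensionality => w.
have [->|w0] := eqVneq w [::]; first exact: F0.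
have -> : F M w = F M w - M w + M w by rewrite subrK.
rewrite (Ftri M (X (size w)) w) //; last by move=> v ltv; exact: Xstable.
have -> : M w = S w - (F (X (size w)) w - X (size w) w) by case: w w0.
by rewrite addrC subrK.
Qed.

Lemma mone_neq0 w : w != [::] -> mone w = 0 :> K.
Proof. by case: w. Qed.

Lemma mmul_recl M N w :
  mmul M N w = M [::] * N w + \sum_(k < size w) M (take k.+1 w) * N (drop k.+1 w).
Proof. by rewrite /mmul big_ord_recl take0 drop0. Qed.

Lemma size_drop_ord w (k : 'I_(size w)) : (size (drop k.+1 w) < size w)%N.
Proof. by rewrite size_drop subnS; case: (size w) k => [[]|m k] //=; rewrite subSn ?ltnS ?leq_subr // -ltnS. Qed.

(** Since [T [::] = 1], left multiplication by [T] is the identity plus terms at proper suffixes,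
    hence triangular; a right inverse exists and [epsilon] selects one. *)
Lemma minvP T : T [::] = 1 -> mmul T (minv T) = @mone K.
Proof.
move=> T0; rewrite /minv.
have [] := @triangular_surj (mmul T) 1 (@mone K).
- by move=> M M0; rewrite mmul_recl /= big_ord0 T0 M0 mulr1 addr0.
- move=> M N w _ _ _ MN; rewrite !mmul_recl T0 !mul1r !(addrC _ (\sum_(k < _) _)) !addrK.
  by apply: eq_bigr => k _; rewrite MN // size_drop_ord.
- by move=> U [_ TU]; exact: (epsilon_spec _ (fun U => mmul T U = @mone K) (ex_intro _ U TU)).
Qed.

Lemma minv0 T : T [::] = 1 -> minv T [::] = 1.
Proof.
move=> T0; move: (congr1 (@^~ [::]) (minvP T0)).
by rewrite /= mmul_recl big_ord0 T0 mul1r addr0.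
Qed.

Lemma minv_rec T w : T [::] = 1 -> w != [::] ->
  minv T w = - \sum_(k < size w) T (take k.+1 w) * minv T (drop k.+1 w).
Proof.
move=> T0 w0; move: (congr1 (@^~ w) (minvP T0)).
by rewrite /= mmul_recl T0 mul1r mone_neq0 // => /eqP; rewrite addr_eq0 => /eqP.
Qed.

Lemma minv_local T T' m : T [::] = 1 -> T' [::] = 1 ->
    (forall v, (size v < m)%N -> T v = T' v) ->
  forall w, (size w < m)%N -> minv T w = minv T' w.
Proof.
move=> T0 T0' TT' w; have [n] := ubnP (size w); elim: n w => // n IH w ltn ltm.
have [->|w0] := eqVneq w [::]; first by rewrite !minv0.
rewrite !minv_rec //; congr (- _); apply: eq_bigr => k _.
rewrite IH ?TT' //.
- by rewrite (leq_ltn_trans _ ltm) // size_take; case: ifP => // /ltnW.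
- by rewrite (leq_trans (size_drop_ord k)) // -ltnS.
- by rewrite (ltn_trans (size_drop_ord k)).
Qed.

(** In each nonzero term [beta] is nonempty and so is the neighbour absorbing it: [beta] is a proper
    factor, and the flexed word is shorter by the length of [beta]. *)
Lemma arit_local M N M' N' w :
    (forall v, (size v < size w)%N -> M v = M' v) ->
    (forall v, (size v < size w)%N -> N v = N' v) ->
  arit N M w = arit N' M' w.
Proof.
move=> MM' NN'; rewrite /arit; case: ifP => // _.
apply: eq_bigr => i _; apply: eq_bigr => j _.
have le_i : (i <= size w)%N by rewrite -ltnS.
have le_j : (j <= size w)%N by rewrite -ltnS.
have size_mid : size (drop i (take j w)) = (j - i)%N by rewrite size_drop size_takel.
congr (_ - _); case: ifP => // /andP [].
- move=> lt_ij lt_j; rewrite MM' ?NN' // ?size_mid.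
  + by rewrite (leq_ltn_trans (leq_subr _ _)).
  + rewrite size_cat size_ceil size_drop size_takel //.
    by rewrite addnBA // ltn_subLR ?ltn_add2r // (leq_trans le_j) // leq_addl.
- move=> i_gt0 lt_ij; rewrite MM' ?NN' // ?size_mid.
  + by rewrite (leq_trans _ le_j) // ltn_subrL i_gt0 (leq_ltn_trans _ lt_ij).
  + rewrite size_cat size_floor size_drop size_takel //.
    by rewrite addnBA // ltn_subLR ?ltn_add2r // (leq_trans le_j) // leq_addl.
Qed.

(** Only the two extreme terms of [mmul] involve the whole word, and they vanish because all four
    moulds are zero at the empty word. *)
Lemma preari_local M N M' N' w :
    M [::] = 0 -> M' [::] = 0 -> N [::] = 0 -> N' [::] = 0 ->
    (forall v, (size v < size w)%N -> M v = M' v) ->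
    (forall v, (size v < size w)%N -> N v = N' v) ->
  preari M N w = preari M' N' w.
Proof.
move=> M0 M0' N0 N0' MM' NN'; rewrite /preari /madd (arit_local MM' NN').
congr (_ + _); apply: eq_bigr => -[[|k] /= ltk] _; first by rewrite !take0 M0 M0' !mul0r.
rewrite ltnS in ltk; have [eqk|nek] := eqVneq k.+1 (size w).
  by rewrite eqk drop_size N0 N0' !mulr0.
rewrite MM' ?NN' // ?size_takel //; last by rewrite ltn_neqAle nek.
exact: (size_drop_ord (Ordinal ltk)).
Qed.

Lemma preari_mone M : preari (@mone K) M = M.
Proof.
apply: functional_extensionality => w; rewrite /preari /madd.
have -> : arit M (@mone K) w = 0.
  rewrite /arit; case: ifP => // _.
  apply: big1 => i _; apply: big1 => j _.
  have -> : (if (i < j < size w)%N then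
               mone (take i w ++ ceil (drop i (take j w)) (drop j w)) * M (drop i (take j w))
             else 0) = 0.
    case: ifP => // /andP [_ lt_jw]; rewrite mone_neq0 ?mul0r //.
    by rewrite -size_eq0 size_cat size_ceil size_drop addn_eq0 negb_and -!lt0n subn_gt0 lt_jw orbT.
  case: ifP => [/andP [i_gt0 _]|_]; rewrite ?subr0 // mone_neq0 ?mul0r ?subr0 //.
  have le_i : (i <= size w)%N by rewrite -ltnS.
  by rewrite -size_eq0 size_cat size_floor size_takel // addn_eq0 negb_and -lt0n i_gt0.
rewrite add0r mmul_recl mul1r big1 ?addr0 // => k _.
by rewrite mone_neq0 ?mul0r // -size_eq0 size_takel.
Qed.

Lemma mmul_nil M N : mmul M N [::] = M [::] * N [::].
Proof. by rewrite mmul_recl big_ord0 addr0. Qed.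

Lemma preari_nil M N : preari M N [::] = M [::] * N [::].
Proof. by rewrite /preari /madd mmul_nil /arit add0r. Qed.

Lemma preari_n_nil M n : M [::] = 0 -> preari_n M n.+1 [::] = 0.
Proof. by move=> M0; rewrite /= preari_nil M0 mulr0. Qed.

(** This makes [expari] triangular: its terms of index at least 2 on [w] depend only on words
    shorter than [w], while the term of index 1 is [M w] itself. *)
Lemma preari_n_local M N m : M [::] = 0 -> N [::] = 0 ->
    (forall v, (size v < m)%N -> M v = N v) ->
  forall n w, (size w <= m)%N -> preari_n M n.+2 w = preari_n N n.+2 w.
Proof.
move=> M0 N0 MN; elim=> [|n IH] w le_wm.
  by rewrite /= !preari_mone; apply: preari_local => // v ltv; apply: MN; apply: leq_trans le_wm.
have M2 := @preari_n_nil M n.+1 M0; have N2 := @preari_n_nil N n.+1 N0.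
apply: (preari_local M2 N2 M0 N0) => v ltv.
  by apply: IH; apply: leq_trans (ltnW ltv) le_wm.
by apply: MN; apply: leq_trans le_wm.
Qed.

Lemma expari_nil M : expari M [::] = 1.
Proof. by rewrite /expari big_ord1 /= divr1. Qed.

Lemma expari_recl M x w :
  expari M (x :: w) = M (x :: w)
    + \sum_(n < size w) preari_n M n.+2 (x :: w) / (n.+2)`!%:R.
Proof.
by rewrite /expari /= big_ord_recl big_ord_recl /= preari_mone mul0r add0r divr1.
Qed.

Lemma logariP S : S [::] = 1 -> logari S [::] = 0 /\ expari (logari S) = S.
Proof.
move=> S0; rewrite /logari.
have [] := @triangular_surj (@expari K) 0 S.
- by move=> M _; rewrite expari_nil S0.
- move=> M N [|x w] // M0 N0 _ MN; rewrite !expari_recl !(addrC _ (\sum_(n < _) _)) !addrK.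
  by apply: eq_bigr => n _; rewrite (preari_n_local M0 N0 MN).
- move=> U HU; exact: (epsilon_spec _ (fun A => is_ARI A /\ expari A = S) (ex_intro _ U HU)).
Qed.

Lemma cutsP n w p : p \in cuts n w -> size p = n /\ flatten p = w.
Proof.
elim: n w p => [|n IH] w p; first by case: w => //=; rewrite inE => /eqP ->.
case/flattenP => _ /mapP [k _ ->] /mapP [q /IH [sq fq] ->] /=.
by rewrite sq fq cat_take_drop.
Qed.

(** Used with one of the two blocks equal to a nonempty [b_i], it shows that [a_i] and [c_i] are
    strictly shorter than the whole word. *)
Lemma size_nth2 (p : seq (seq K)) i j : (i < j < size p)%N ->
  (size (nth [::] p i) + size (nth [::] p j) <= size (flatten p))%N.
Proof.
have size_nth1 (q : seq (seq K)) k : (size (nth [::] q k) <= size (flatten q))%N.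
  elim: q k => [|v q IH] [|k] //=; rewrite size_cat ?leq_addr //.
  exact: leq_trans (IH k) (leq_addl _ _).
elim: p i j => [|v p IH] [|i] [|j] //=; rewrite size_cat.
  by rewrite leq_add2l.
by rewrite !ltnS => /IH h; apply: leq_trans h (leq_addl _ _).
Qed.

(** [T] enters only at the blocks [a_i] and, through [minv T], at the blocks [c_i]; these are proper
    factors because [b_i] is nonempty. *)
Lemma garit_local S T T' w : w != [::] -> T [::] = 1 -> T' [::] = 1 ->
    (forall v, (size v < size w)%N -> T v = T' v) ->
  garit T S w = garit T' S w.
Proof.
move=> w0 T0 T0' TT'; have TiTi' := minv_local T0 T0' TT'.
case: w w0 TT' TiTi' => // x w _ TT' TiTi'; rewrite /garit.
apply: eq_bigr => s _; rewrite !big_seq; apply: eq_bigr => p /cutsP [size_p flat_p].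
case: ifP => // /andP [/forallP bne _]; congr (_ * _); apply: eq_bigr => i _.
have b_gt0 : (0 < size (nth [::] p (3 * i).+1))%N by rewrite lt0n size_eq0 bne.
have lt_3i : ((3 * i).+2 < size p)%N by rewrite size_p -(ltn_subRL 2); case: i {bne b_gt0} => i /=; lia.
rewrite TT' ?TiTi' // -flat_p.
- by rewrite (leq_trans _ (@size_nth2 p (3 * i).+1 (3 * i).+2 _)) ?ltnSn ?lt_3i // -addn1 addnC leq_add2r.
- by rewrite (leq_trans _ (@size_nth2 p (3 * i) (3 * i).+1 _)) ?ltnSn ?(ltnW lt_3i) // -addn1 leq_add2l.
Qed.

Lemma gari_recl S T w : gari S T w = T w + \sum_(k < size w) garit T S (take k.+1 w) * T (drop k.+1 w).
Proof. by rewrite /gari mmul_recl mul1r. Qed.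

Lemma invgariP S : S [::] = 1 -> invgari S [::] = 1 /\ gari S (invgari S) = @mone K.
Proof.
move=> S0; rewrite /invgari.
have [] := @triangular_surj (gari S) 1 (@mone K).
- by move=> M M0; rewrite gari_recl big_ord0 M0 addr0.
- move=> M N w M0 N0 _ MN; rewrite !gari_recl !(addrC _ (\sum_(k < _) _)) !addrK.
  apply: eq_bigr => k _; rewrite MN ?size_drop_ord //; congr (_ * _).
  (* On the prefix of length [k.+1], [garit] uses [T] only in lengths at most [k], which is below
     [size w]. *)
  apply: garit_local => //; first by rewrite -size_eq0 size_takel.
  by move=> v; rewrite size_takel // => ltv; apply: MN; apply: leq_trans ltv _.
- move=> U HU; exact: (epsilon_spec _ (fun T => is_GARI T /\ gari S T = @mone K) (ex_intro _ U HU)).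
Qed.

(** * Expansions in lengths at most 3 *)

(* [garit_term] and [garitE] restate [garit] with iterations over lists instead
   of locked big operators, so that it evaluates on a word of given length. *)
Definition nonnil w := if w is [::] then false else true.

Definition garit_term T Ti S (s : nat) (p : seq (seq K)) : K :=
  if all (fun i => nonnil (nth [::] p (3 * i).+1)) (iota 0 s) &&
     all (fun i => if (s - i.+1)%N is 0 then true else
                   nonnil (nth [::] p (3 * i).+2 ++ nth [::] p (3 * i.+1))) (iota 0 s)
  then S (flatten [seq flex (nth [::] p (3 * i)) (nth [::] p (3 * i).+1)
                            (nth [::] p (3 * i).+2) | i <- iota 0 s])
       * foldr (fun i r => T (nth [::] p (3 * i)) * Ti (nth [::] p (3 * i).+2) * r)
               1 (iota 0 s)
  else 0.

Lemma forall_ord_all (s : nat) (P : pred nat) :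
  [forall i : 'I_s, P i] = all P (iota 0 s).
Proof.
apply/forallP/allP => [h i | h i]; first by rewrite mem_iota => /= lt_i; exact: (h (Ordinal lt_i)).
by apply: h; rewrite mem_iota /=.
Qed.

Lemma big_foldr (R I : Type) (op : R -> R -> R) idx (r : seq I) (F : I -> R) :
  \big[op/idx]_(i <- r) F i = foldr (fun i a => op (F i) a) idx r.
Proof. by elim: r => [|i r IH] /=; rewrite ?big_nil // big_cons IH. Qed.

Lemma garitE T S w : w != [::] ->
  garit T S w = foldr (fun s r =>
     foldr (fun p r' => garit_term T (minv T) S s p + r') 0 (cuts (3 * s) w) + r)
     0 (iota 1 (size w)).
Proof.
case: w => // x w _; rewrite /garit -big_foldr.
rewrite /index_iota subSS subn0.
apply: eq_bigr => s _; rewrite -big_foldr; apply: eq_bigr => p _.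
rewrite /garit_term.
rewrite (forall_ord_all s (fun i => nth [::] p (3 * i).+1 != [::])).
rewrite (forall_ord_all s (fun i => (i.+1 < s)%N ==> (nth [::] p (3 * i).+2 ++ nth [::] p (3 * i.+1) != [::]))).
have nilE (t : seq K) : (t != [::]) = nonnil t by case: t.
rewrite -[foldr (fun i r => _ * _ * r) _ _]big_foldr.
rewrite -(big_mkord xpredT (fun i => T (nth [::] p (3 * i)) * minv T (nth [::] p (3 * i).+2))).
rewrite /index_iota subn0.
rewrite (eq_all (a2 := fun i => nonnil (nth [::] p (3 * i).+1))); last by move=> i; rewrite nilE.
rewrite [X in _ && X](eq_all (a2 := fun i => if (s - i.+1)%N is 0 then true else nonnil (nth [::] p (3 * i).+2 ++ nth [::] p (3 * i.+1)))) //.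
by move=> i; rewrite nilE -subn_gt0; case: (s - i.+1)%N.
Qed.

(** Only list and index functions are unfolded, so the sum over cuts is enumerated while the field
    operations stay symbolic for [ring]. *)
Ltac garit_compute :=
  rewrite garitE //;
  lazy [size iota foldr cuts flatten map cat take drop muln muln_rec addn
        addn_rec Nat.mul Nat.add garit_term all nonnil nth andb negb implb subn
        subn_rec Nat.sub flex ceil floor rcons belast last head behead].

Ltac flex_simpl := rewrite ?wsumE ?big_nil ?(add0r, addr0, addrA).

Lemma garit1 T S x : T [::] = 1 -> garit T S [:: x] = S [:: x].
Proof. by move=> T0; garit_compute; rewrite minv0 // T0; flex_simpl; rewrite !mulr1. Qed.

Lemma garit2 T S x y : T [::] = 1 ->
  garit T S [:: x; y] = S [:: x; y] + S [:: x + y] * (T [:: x] + minv T [:: y]).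
Proof. by move=> T0; garit_compute; rewrite minv0 // T0; flex_simpl; ring. Qed.

(** The terms [S [:: x + y; z] * minv T [:: y]] and [S [:: x; y + z] * T [:: y]] come from [s = 2],
    where the middle letter is [c_1] or [a_2]; all others come from [s = 1]. *)
Lemma garit3 T S x y z : T [::] = 1 ->
  garit T S [:: x; y; z] = S [:: x; y; z] + S [:: x + y; z] * (T [:: x] + minv T [:: y])
    + S [:: x; y + z] * (T [:: y] + minv T [:: z])
    + S [:: x + y + z] * (T [:: x; y] + T [:: x] * minv T [:: z] + minv T [:: y; z]).
Proof. by move=> T0; garit_compute; rewrite minv0 // T0; flex_simpl; ring. Qed.

Lemma mmul1 M N x : mmul M N [:: x] = M [::] * N [:: x] + M [:: x] * N [::].
Proof. by rewrite /mmul !big_ord_recr big_ord0 /= add0r. Qed.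

Lemma mmul2 M N x y :
  mmul M N [:: x; y] = M [::] * N [:: x; y] + M [:: x] * N [:: y] + M [:: x; y] * N [::].
Proof. by rewrite /mmul !big_ord_recr big_ord0 /= add0r. Qed.

Lemma mmul3 M N x y z :
  mmul M N [:: x; y; z] = M [::] * N [:: x; y; z] + M [:: x] * N [:: y; z]
    + M [:: x; y] * N [:: z] + M [:: x; y; z] * N [::].
Proof. by rewrite /mmul !big_ord_recr big_ord0 /= add0r. Qed.

Lemma arit2 M N x y : arit N M [:: x; y] = M [:: x + y] * (N [:: x] - N [:: y]).
Proof. rewrite /arit /= !big_ord_recr !big_ord0 /=; flex_simpl; ring. Qed.

Lemma arit3 M N x y z : arit N M [:: x; y; z] =
  M [:: x + y; z] * (N [:: x] - N [:: y]) + M [:: x; y + z] * (N [:: y] - N [:: z])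
    + M [:: x + y + z] * (N [:: x; y] - N [:: y; z]).
Proof. rewrite /arit /= !big_ord_recr !big_ord0 /=; flex_simpl; ring. Qed.

Lemma preari1 M N x : preari M N [:: x] = M [::] * N [:: x] + M [:: x] * N [::].
Proof. by rewrite /preari /madd /arit /= mmul1 add0r. Qed.

Lemma preari2 M N x y : M [::] = 0 -> N [::] = 0 ->
  preari M N [:: x; y] = M [:: x + y] * (N [:: x] - N [:: y]) + M [:: x] * N [:: y].
Proof. by move=> M0 N0; rewrite /preari /madd arit2 mmul2 M0 N0; ring. Qed.

Lemma preari3 M N x y z : M [::] = 0 -> N [::] = 0 ->
  preari M N [:: x; y; z] =
    M [:: x + y; z] * (N [:: x] - N [:: y]) + M [:: x; y + z] * (N [:: y] - N [:: z])
    + M [:: x + y + z] * (N [:: x; y] - N [:: y; z])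
    + M [:: x] * N [:: y; z] + M [:: x; y] * N [:: z].
Proof. by move=> M0 N0; rewrite /preari /madd arit3 mmul3 M0 N0; ring. Qed.

Lemma expari1 M x : expari M [:: x] = M [:: x].
Proof. by rewrite expari_recl big_ord0 addr0. Qed.

Lemma expari2 M x y : expari M [:: x; y] = M [:: x; y] + preari M M [:: x; y] / 2.
Proof. by rewrite expari_recl big_ord1 /= preari_mone. Qed.

Lemma expari3 M x y z : expari M [:: x; y; z] =
  M [:: x; y; z] + preari M M [:: x; y; z] / 2 + preari (preari M M) M [:: x; y; z] / 6.
Proof. by rewrite expari_recl big_ord_recl big_ord1 /= preari_mone addrA. Qed.

Lemma minv1 T x : T [::] = 1 -> minv T [:: x] = - T [:: x].
Proof. by move=> T0; rewrite minv_rec // big_ord1 /= minv0 // mulr1. Qed.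

Lemma minv2 T x y : T [::] = 1 -> minv T [:: x; y] = T [:: x] * T [:: y] - T [:: x; y].
Proof.
by move=> T0; rewrite minv_rec // big_ord_recl big_ord1 /= minv1 // minv0 //; ring.
Qed.

Lemma garit_nil T S : garit T S [::] = 1.
Proof. by []. Qed.

Lemma gari_nil S T : gari S T [::] = T [::].
Proof. by rewrite gari_recl big_ord0 addr0. Qed.

Lemma gari1 S T x : T [::] = 1 -> gari S T [:: x] = S [:: x] + T [:: x].
Proof. by move=> T0; rewrite /gari mmul1 garit_nil garit1 // T0; ring. Qed.

Lemma gari2 S T x y : T [::] = 1 -> gari S T [:: x; y] =
  S [:: x; y] + S [:: x + y] * (T [:: x] - T [:: y]) + S [:: x] * T [:: y] + T [:: x; y].
Proof.
by move=> T0; rewrite /gari mmul2 garit_nil garit1 // garit2 // minv1 // T0; ring.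
Qed.

Lemma gari3 S T x y z : T [::] = 1 -> gari S T [:: x; y; z] =
  S [:: x; y; z] + S [:: x + y; z] * (T [:: x] - T [:: y])
    + S [:: x; y + z] * (T [:: y] - T [:: z])
    + S [:: x + y + z] * (T [:: x; y] - T [:: x] * T [:: z] + T [:: y] * T [:: z] - T [:: y; z])
    + (S [:: x; y] + S [:: x + y] * (T [:: x] - T [:: y])) * T [:: z]
    + S [:: x] * T [:: y; z] + T [:: x; y; z].
Proof.
move=> T0; rewrite /gari mmul3 garit_nil garit1 // garit2 // garit3 //.
by rewrite !minv1 // minv2 // T0; ring.
Qed.

Lemma ari_nil M N : M [::] = 0 -> N [::] = 0 -> ari M N [::] = 0.
Proof. by move=> M0 N0; rewrite /ari /msub !preari_nil M0 N0 mulr0 subrr. Qed.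

Lemma ari1 M N x : M [::] = 0 -> N [::] = 0 -> ari M N [:: x] = 0.
Proof. by move=> M0 N0; rewrite /ari /msub !preari1 M0 N0 !(mulr0, mul0r) addr0 subrr. Qed.

Lemma ari2 M N x y : M [::] = 0 -> N [::] = 0 -> ari M N [:: x; y] =
  M [:: x + y] * (N [:: x] - N [:: y]) + M [:: x] * N [:: y]
  - (N [:: x + y] * (M [:: x] - M [:: y]) + N [:: x] * M [:: y]).
Proof. by move=> M0 N0; rewrite /ari /msub !preari2. Qed.

Lemma ari3 M N x y z : M [::] = 0 -> N [::] = 0 -> ari M N [:: x; y; z] =
  M [:: x + y; z] * (N [:: x] - N [:: y]) + M [:: x; y + z] * (N [:: y] - N [:: z])
    + M [:: x + y + z] * (N [:: x; y] - N [:: y; z])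
    + M [:: x] * N [:: y; z] + M [:: x; y] * N [:: z]
  - (N [:: x + y; z] * (M [:: x] - M [:: y]) + N [:: x; y + z] * (M [:: y] - M [:: z])
    + N [:: x + y + z] * (M [:: x; y] - M [:: y; z])
    + N [:: x] * M [:: y; z] + N [:: x; y] * M [:: z]).
Proof. by move=> M0 N0; rewrite /ari /msub !preari3. Qed.

(** * The adjoint action in lengths at most 3 *)

Implicit Types (u v : K).
Hypothesis char0 : forall n, n.+1%:R != 0 :> K.

Lemma two_neq0 : 2 != 0 :> K. Proof. exact: (char0 1). Qed.

Lemma twelve_neq0 : 12 != 0 :> K. Proof. exact: (char0 11). Qed.

Section Adari.
Variables (S A : mould K).
Hypotheses (S0 : S [::] = 1) (A0 : A [::] = 0).

Lemma invgari1 x : invgari S [:: x] = - S [:: x].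
Proof.
have [T0 ST] := invgariP S0.
move: (congr1 (@^~ [:: x]) ST); rewrite /= gari1 // => /eqP.
by rewrite addrC addr_eq0 => /eqP.
Qed.

Lemma invgari2 x y : invgari S [:: x; y] =
  - S [:: x; y] + S [:: x + y] * (S [:: x] - S [:: y]) + S [:: x] * S [:: y].
Proof.
have [T0 ST] := invgariP S0.
move: (congr1 (@^~ [:: x; y]) ST); rewrite /= gari2 // => /eqP.
by rewrite addrC addr_eq0 => /eqP ->; rewrite !invgari1; ring.
Qed.

(** In a conjugate by [S], the length-three components of [S] and [invgari S] occur only through
    their sum. Solving for the former lets the latter cancel, so neither has to be known. *)
Lemma gari_invgari3 x y z : S [:: x; y; z] = - (
    S [:: x + y; z] * (invgari S [:: x] - invgari S [:: y])
    + S [:: x; y + z] * (invgari S [:: y] - invgari S [:: z])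
    + S [:: x + y + z] * (invgari S [:: x; y] - invgari S [:: x] * invgari S [:: z]
                          + invgari S [:: y] * invgari S [:: z] - invgari S [:: y; z])
    + (S [:: x; y] + S [:: x + y] * (invgari S [:: x] - invgari S [:: y])) * invgari S [:: z]
    + S [:: x] * invgari S [:: y; z] + invgari S [:: x; y; z]).
Proof.
have [T0 ST] := invgariP S0.
move: (congr1 (@^~ [:: x; y; z]) ST); rewrite /= gari3 // => /eqP.
by rewrite -!addrA addr_eq0 => /eqP.
Qed.

Lemma adari_def :
  adari S A [::] = 0 /\ expari (adari S A) = gari (gari S (expari A)) (invgari S).
Proof. by apply: logariP; rewrite gari_nil; case: (invgariP S0). Qed.

Lemma adari_nil : adari S A [::] = 0.
Proof. exact: adari_def.1. Qed.

Lemma expari_adari : expari (adari S A) = gari (gari S (expari A)) (invgari S).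
Proof. exact: adari_def.2. Qed.

Lemma adari1 x : adari S A [:: x] = A [:: x].
Proof.
have [T0 _] := invgariP S0.
by rewrite -expari1 expari_adari !gari1 ?gari_nil ?expari_nil // invgari1 expari1; ring.
Qed.

(** The correction is the length-two expression of [ari S A]: the terms quadratic in [A] agree on
    both sides of [expari_adari], and those quadratic in [S] cancel. *)
Lemma adari2 x y : adari S A [:: x; y] = A [:: x; y] +
  (S [:: x + y] * (A [:: x] - A [:: y]) + S [:: x] * A [:: y]
   - (A [:: x + y] * (S [:: x] - S [:: y]) + A [:: x] * S [:: y])).
Proof.
have [T0 _] := invgariP S0.
move: (congr1 (@^~ [:: x; y]) expari_adari) => /=.
rewrite expari2 preari2 ?adari_nil // !adari1 gari2 // !gari1 ?expari_nil // gari2 ?expari_nil //.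
rewrite !expari1 expari2 preari2 // !invgari1 invgari2.
(* Both equations are put in the form [_ = 0]; replacing the zero of the goal by the left side of
   [h] leaves a rational identity. *)
move/eqP; rewrite -subr_eq0 => /eqP h.
apply/eqP; rewrite -subr_eq0; apply/eqP; rewrite -[RHS]h.
by field; exact: two_neq0.
Qed.

Section Length3.
Hypotheses (A2 : forall x y, A [:: x; y] = 0) (A3 : forall x y z, A [:: x; y; z] = 0).

(* The first two hypotheses say that [S] agrees with [expari (- s)] in lengths 1
   and 2; they are required only at the words met in the expansion, since for
   [pal] they fail where a denominator vanishes. *)
Lemma adari3 (s : mould K) x y z :
   {in [:: x; y; z; x + y; y + z; x + y + z], forall u, S [:: u] = - s [:: u]} ->
   {in [:: (x, y); (y, z); (x + y, z); (x, y + z)], forall p,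
       S [:: p.1; p.2] = - s [:: p.1; p.2] + preari s s [:: p.1; p.2] / 2} ->
   s [::] = 0 ->
  adari S A [:: x; y; z] =
    ari A s [:: x; y; z] + 2^-1 * ari (ari A s) s [:: x; y; z].
Proof.
move=> S1 S2 s0.
have [T0 _] := invgariP S0.
have As0 : ari A s [::] = 0 by rewrite /ari /msub !preari_nil A0 s0 mulr0 subrr.
have As1 u : ari A s [:: u] = 0.
  by rewrite /ari /msub !preari1 A0 s0 !(mulr0, mul0r) addr0 subrr.
move: (congr1 (@^~ [:: x; y; z]) expari_adari) => /=.
rewrite expari3 !preari3 ?preari_nil ?adari_nil ?mulr0 //.
rewrite !preari2 ?adari_nil // !preari1 adari_nil !adari2 !adari1.
rewrite gari3 // !gari1 ?expari_nil // !gari2 ?expari_nil // gari3 ?expari_nil //.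
rewrite gari_invgari3 !invgari2 !invgari1.
rewrite !expari1 !expari2 expari3 !preari3 ?preari_nil ?A0 ?mulr0 // !preari2 // !preari1 A0 A3 !A2.
rewrite !ari3 // !ari2 // !As1 !A2.
have e1 : S [:: x] = - s [:: x] by apply: S1; rewrite !inE eqxx ?orbT.
have e2 : S [:: y] = - s [:: y] by apply: S1; rewrite !inE eqxx ?orbT.
have e3 : S [:: z] = - s [:: z] by apply: S1; rewrite !inE eqxx ?orbT.
have e4 : S [:: x + y] = - s [:: x + y] by apply: S1; rewrite !inE eqxx ?orbT.
have e5 : S [:: y + z] = - s [:: y + z] by apply: S1; rewrite !inE eqxx ?orbT.
have e6 : S [:: x + y + z] = - s [:: x + y + z] by apply: S1; rewrite !inE eqxx ?orbT.
have e7 := S2 (x, y) (mem_head _ _).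
have e8 : S [:: y; z] = - s [:: y; z] + preari s s [:: y; z] / 2
  by apply: (S2 (y, z)); rewrite !inE eqxx ?orbT.
have e9 : S [:: x + y; z] = - s [:: x + y; z] + preari s s [:: x + y; z] / 2
  by apply: (S2 (x + y, z)); rewrite !inE eqxx ?orbT.
have e10 : S [:: x; y + z] = - s [:: x; y + z] + preari s s [:: x; y + z] / 2
  by apply: (S2 (x, y + z)); rewrite !inE eqxx ?orbT.
rewrite /= !preari2 // in e7 e8 e9 e10.
(* Reassociation identifies the sum [x + (y + z)] arising from the pair [(x, y + z)] with
   [x + y + z]. *)
rewrite e7 e8 e9 e10 ?(addrA x y z) e1 e2 e3 e4 e5 e6.
move/eqP; rewrite -subr_eq0 => /eqP h.
apply/eqP; rewrite -subr_eq0; apply/eqP; rewrite -[RHS]h.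
by field; rewrite (char0 1) (char0 5).
Qed.

End Length3.
End Adari.

(** * The moulds pal, paj, sang and slang *)

(** The factor [u^-1 * u] is not simplified because it is 0 at [u = 0]. *)
Lemma dupal1 u : dupal [:: u] = - 2^-1 * (u^-1 * u).
Proof.
rewrite /dupal big_seq1 big_ord1 /= bin0.
have -> : bernoulli 1 / (1`!)%:R = - 2^-1 :> rat.
  by rewrite /bernoulli /= big_ord1 /=.
rewrite /ratr; have -> : numq (- 2^-1) = -1 by [].
have -> : denq (- 2^-1) = 2 by [].
by rewrite expr0 !mul1r mulN1r mulrA.
Qed.

Lemma dupal2 u v : dupal [:: u; v] = 12^-1 * (u * v)^-1 * (u - v).
Proof.
rewrite /dupal !big_cons big_nil /= !big_ord_recr big_ord0 /= !bin0.
have -> : bernoulli 2 / (2`!)%:R = 12^-1 :> rat.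
  by rewrite /bernoulli /= !big_ord_recr !big_ord0 /=.
rewrite /ratr; have -> : numq (12^-1) = 1 by [].
have -> : denq (12^-1) = 12 by [].
change (binomial 1 1) with 1%N; rewrite expr0 expr1 !mulr1 -!pmulrn; ring.
Qed.

Local Arguments dupal : simpl never.

Lemma pal_nil : pal [::] = 1 :> K. Proof. by []. Qed.

Lemma pal1 u : pal [:: u] = - s' [:: u].
Proof.
rewrite /pal /= big_ord1 /= wsum1 dupal1 mul1r.
(* With the convention [0^-1 = 0], both sides vanish at [u = 0]. *)
have [->|u0] := eqVneq u 0; first by rewrite invr0 mul0r mulr0 invr0 oppr0.
by field; rewrite u0 two_neq0.
Qed.

Lemma pal2 u v : u != 0 -> v != 0 -> u + v != 0 ->
  pal [:: u; v] = - s' [:: u; v] + preari (@s' K) (@s' K) [:: u; v] / 2.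
Proof.
move=> u0 v0 uv0; rewrite preari2 // /pal /= !big_ord_recr !big_ord0 /=.
(* The denominator [x1 - x2 = u - (u + v)] of [s'] becomes [- v]. *)
rewrite !wsumE !dupal1 dupal2 opprD addNKr.
by field; rewrite oppr_eq0 u0 v0 uv0 two_neq0 twelve_neq0.
Qed.

Lemma paj_nil : paj [::] = 1 :> K. Proof. by rewrite /paj big_ord0. Qed.
Lemma paj1 u : paj [:: u] = u^-1. Proof. by rewrite /paj big_ord1 wsum1. Qed.

Section Sang.
Variable A : mould K.
Hypothesis A0 : A [::] = 0.

Let N := mmul (mmul (minv (@paj K)) A) (@paj K).

Lemma conj_paj_nil : N [::] = 0. Proof. by rewrite /N !mmul_nil A0 mulr0 mul0r. Qed.

Lemma conj_paj1 u : N [:: u] = A [:: u].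
Proof. by rewrite /N !mmul1 !mmul_nil A0 paj_nil minv0 ?paj_nil //; ring. Qed.

Lemma conj_paj2 u v : N [:: u; v] = A [:: u; v] - u^-1 * A [:: v] + A [:: u] / v.
Proof. by rewrite /N !mmul2 !mmul1 !mmul_nil A0 paj_nil minv1 ?minv0 ?paj_nil // !paj1; ring. Qed.

Lemma sang_nil : sang A [::] = 0.
Proof.
by rewrite /sang /mscale /madd /neg /= adari_nil ?paj_nil // -/N conj_paj_nil addr0 mulr0.
Qed.

Lemma sang1 u : sang A [:: u] = 2^-1 * (A [:: u] + A [:: - u]).
Proof.
by rewrite /sang /mscale /madd /neg /= adari1 ?paj_nil // -/N ?conj_paj_nil // !conj_paj1.
Qed.

(** In the negated half, the product terms of [adari2] for [paj] cancel those of the conjugation by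
    [paj]; only flexion terms remain. *)
Lemma sang2 u v : sang A [:: u; v] = 2^-1 *
  (A [:: u; v] - u^-1 * A [:: v] + A [:: u] / v + (A [:: - u; - v]
  - (u + v)^-1 * (A [:: - u] - A [:: - v]) + A [:: - (u + v)] * (u^-1 - v^-1))).
Proof.
rewrite /sang /mscale /madd /neg /= adari2 ?paj_nil // -/N ?conj_paj_nil // !conj_paj2 !conj_paj1 !paj1.
by rewrite -opprD !invrN; ring.
Qed.

End Sang.

Lemma invgari_pal_nil : invgari (@pal K) [::] = 1.
Proof. by case: (invgariP pal_nil). Qed.

Lemma slang2_nil A : A [::] = 0 -> slang 2 A [::] = 0.
Proof. by move=> A0; rewrite /slang adari_nil ?pal_nil. Qed.

Lemma slang2_1 A u : slang 2 A [:: u] = 0.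
Proof. by rewrite /slang adari1 ?pal_nil. Qed.

(** By [adari2] both adjoint actions are trivial in length 2 on moulds without length-one part. *)
Lemma slang2_2 A u v : A [::] = 0 -> (forall x, sang A [:: x] = 0) ->
  slang 2 A [:: u; v] = sang A [:: u; v].
Proof.
move=> A0 sang0; rewrite /slang adari2 ?pal_nil // /leng /=.
by rewrite adari2 ?invgari_pal_nil ?sang_nil // !sang0; ring.
Qed.

Lemma sang_even A : A [::] = 0 -> (forall u, A [:: - u] = A [:: u]) ->
  forall u, sang A [:: u] = A [:: u].
Proof.
by move=> A0 Aeven u; rewrite sang1 // Aeven; field; apply: two_neq0.
Qed.

(** The inner [adari] preserves the length-one part, and [sang] fixes it by evenness; so the mould
    to which [adari pal] is applied is [A] itself. *)
Lemma slang1_even A : A [::] = 0 -> (forall u, A [:: - u] = A [:: u]) ->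
  (forall w, size w != 1 -> A w = 0) -> slang 1 A = adari (@pal K) A.
Proof.
move=> A0 Aeven A1; congr adari; apply: functional_extensionality => w.
rewrite /leng; case: eqVneq => [|/A1 ->//].
case: w => [|u [|v w]] // _.
by rewrite adari1 ?invgari_pal_nil ?sang_nil // sang_even.
Qed.

Lemma sa_exp k u : sa K k.+1 [:: u] = u ^+ k.
Proof. by rewrite /sa -addn1 PoszD addrK. Qed.

Lemma sa_exp_odd k u : sa K (2 * k + 1)%N [:: u] = u ^+ (2 * k).
Proof. by rewrite addn1 sa_exp. Qed.

Lemma sa_m1 u : sa K (-1) [:: u] = u ^- 2.
Proof. by []. Qed.

Lemma sa_size s w : size w != 1%N -> sa K s w = 0.
Proof. by case: w => [|u [|v w]]. Qed.

Lemma slang1_sa n : slang 1 (sa K (2 * n + 1)%N) = adari (@pal K) (sa K (2 * n + 1)%N).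
Proof.
apply: slang1_even => // [u|w]; last exact: sa_size.
by rewrite !sa_exp_odd !exprM sqrrN.
Qed.

Lemma slang2_sa b u v : (0 < b)%N ->
  slang 2 (sa K (2 * b)%N) [:: u; v] = 2^-1 *
   (u ^+ (2 * b).-1 / v - v ^+ (2 * b).-1 / u
    + (u ^+ (2 * b).-1 - v ^+ (2 * b).-1) / (u + v) - (u + v) ^+ (2 * b).-1 * (u^-1 - v^-1)).
Proof.
move=> b0.
have -> : (2 * b)%N = (2 * b).-1.+1 by rewrite prednK // muln_gt0.
set k := (2 * b).-1; rewrite -/k /=.
(* Oddness of [k] makes [sa (2b)] an odd function, so its [sang] vanishes in length 1 and [slang2_2]
   applies. *)
have odd_k : odd k by rewrite /k -subn1 oddB ?muln_gt0 // oddM.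
have expN x : (- x) ^+ k = - x ^+ k by rewrite exprNn -signr_odd odd_k expr1 mulN1r.
rewrite slang2_2 //; first last.
  by move=> x; rewrite sang1 // !sa_exp expN subrr mulr0.
rewrite sang2 // !sa_exp !expN /=.
by ring.
Qed.

(** The remainders lie in [R], so division by [x] and [x ^+ 2] stays in [R]. The exponents [k] and
    [k.+1] serve the simple and the double poles. *)
Lemma binomial_mod_sqr (R : comNzRingType) (x y : R) k : exists q1 q2,
  (x + y) ^+ k = y ^+ k + x * q1 /\
  (x + y) ^+ k.+1 = y ^+ k.+1 + k.+1%:R * x * y ^+ k + x ^+ 2 * q2.
Proof.
elim: k => [|k [q1 [q2 [_ IH]]]].
  by exists 0, 0; rewrite !expr0 !expr1; split; ring.
(* The first witness factors [x] out of the previous expansion; the second collects the multiples of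
   [x ^+ 2] after multiplying it by [x + y]. *)
exists (k.+1%:R * y ^+ k + x * q2), (q2 * (x + y) + k.+1%:R * y ^+ k).
split; first by rewrite IH; ring.
rewrite exprS IH !exprS -[k.+2]addn1 natrD; ring.
Qed.

(** * Comparison of [adari pal] with the series [xi'] *)

Section AdariPal.
Variable A : mould K.
Hypotheses (A0 : A [::] = 0) (A2 : forall x y, A [:: x; y] = 0)
  (A3 : forall x y z, A [:: x; y; z] = 0).

Lemma xi'_nil : xi' A [::] = 0.
Proof. by rewrite /xi' /madd /mscale !ari_nil ?A0 ?mulr0 ?addr0. Qed.

Lemma adari_pal1 x : adari (@pal K) A [:: x] = xi' A [:: x].
Proof. by rewrite adari1 // /xi' /madd /mscale !ari1 ?ari_nil // mulr0 !addr0. Qed.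

Lemma adari_pal2 x y : adari (@pal K) A [:: x; y] = xi' A [:: x; y].
Proof.
rewrite adari2 // /xi' /madd /mscale [ari (ari _ _) _ _]ari2 ?ari_nil // !ari1 // ari2 // A2 !pal1 //.
ring.
Qed.

(** The nonvanishing conditions are those of [pal2] at the four pairs [(x, y)], [(y, z)],
    [(x + y, z)] and [(x, y + z)]. *)
Lemma adari_pal3 x y z :
    x != 0 -> y != 0 -> z != 0 -> x + y != 0 -> y + z != 0 -> x + y + z != 0 ->
  adari (@pal K) A [:: x; y; z] = xi' A [:: x; y; z].
Proof.
move=> x0 y0 z0 xy0 yz0 xyz0; rewrite /xi' /madd /mscale A3 add0r.
apply: adari3 => //; first by move=> u _; apply: pal1.
by move=> p; rewrite !inE => /or4P [] /eqP -> /=; apply: pal2; rewrite ?addrA.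
Qed.
End AdariPal.

(* Each of the three polar parts of [Dkernel] (along [u], [v], [u + v]) has this
   shape. *)
Lemma binomial_quotient u b (a1 a0 v1 v0 q1 q2 : K) : u != 0 ->
  a0 = v0 + u * q1 -> a1 = v1 + (2 * b) * u * v0 + u ^+ 2 * q2 ->
  (a1 - v1) / u ^+ 2 - b * (v0 + a0) / u = q2 - b * q1.
Proof. by move=> u0 -> ->; field. Qed.

(** * Cancellation of the poles of [E] and integrality of $D_{a,b}$ *)

Definition Dkernel b : mould K :=
  madd (ari (sa K (2 * b + 1)%N) (sa K (-1)))
       (mscale (2 * b)%:R (slang 2 (sa K (2 * b)%N))).

(** Terms are grouped by pole: the double poles come from [sa (-1)], the simple ones from
    [slang 2]. *)
Lemma DkernelE b u v : (0 < b)%N -> u != 0 -> v != 0 -> u + v != 0 ->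
  let k := (2 * b).-1 in
  Dkernel b [:: u; v] =
    (((u + v) ^+ k.+1 - v ^+ k.+1) / u ^+ 2 - b%:R * (v ^+ k + (u + v) ^+ k) / u)
  - (((u + v) ^+ k.+1 - u ^+ k.+1) / v ^+ 2 - b%:R * (u ^+ k + (u + v) ^+ k) / v)
  - ((u ^+ k.+1 - v ^+ k.+1) / (u + v) ^+ 2 - b%:R * (- v ^+ k + u ^+ k) / (u + v)).
Proof.
move=> b0 u0 v0 uv0 k.
have kS : k.+1 = (2 * b)%N by rewrite prednK // muln_gt0.
rewrite /Dkernel /madd /mscale ari2 // slang2_sa // -/k !sa_exp_odd -kS !sa_m1 kS natrM.
move: (_ ^+ (2 * b)) (_ ^+ (2 * b)) (_ ^+ (2 * b)) (_ ^+ k) (_ ^+ k) (_ ^+ k) => a1 a2 a3 a4 a5 a6.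
by field; rewrite uv0 v0 u0 two_neq0.
Qed.

Variables (R : comNzRingType) (phi : {rmorphism R -> K}).

Lemma Dkernel_integral b (p q : R) : (0 < b)%N ->
    phi p != 0 -> phi q != 0 -> phi p + phi q != 0 ->
  exists r, Dkernel b [:: phi p; phi q] = phi r.
Proof.
move=> b0 p0 q0 pq0; rewrite DkernelE //.
set k := (2 * b).-1.
have kS : k.+1 = (2 * b)%N by rewrite prednK // muln_gt0.
have odd_k : odd k by rewrite /k -subn1 oddB ?muln_gt0 // oddM.
have expN (x : R) : (- x) ^+ k = - x ^+ k by rewrite exprNn -signr_odd odd_k expr1 mulN1r.
have expNS (x : R) : (- x) ^+ k.+1 = x ^+ k.+1 by rewrite kS !exprM sqrrN.
(* The linear coefficient of the expansion is [2 * b], the value for which the simple poles cancel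
   in [binomial_quotient]. *)
have kSK : phi k.+1%:R = 2 * b%:R by rewrite rmorph_nat kS natrM.
have [q1 [q2 [e1 e2]]] := binomial_mod_sqr p q k.
have [q1' [q2' [e1' e2']]] := binomial_mod_sqr q p k.
(* For the pole along [u + v], the power of [p = (p + q) + (- q)] is expanded; the parity of [k]
   then gives the signs in [DkernelE]. *)
have [q1'' [q2'' [e1'' e2'']]] := binomial_mod_sqr (p + q) (- q) k.
rewrite addrK !expN !expNS in e1'' e2''.
rewrite (addrC q p) in e1' e2'.
exists ((q2 - b%:R * q1) - (q2' - b%:R * q1') - (q2'' - b%:R * q1'')).
rewrite !rmorphB !rmorphM !rmorph_nat.
pose morphE := (rmorphD phi, rmorphM phi, rmorphXn phi, rmorphN phi).
congr (_ - _ - _); apply: binomial_quotient => //.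
- by move: (congr1 phi e1); rewrite !morphE.
- by move: (congr1 phi e2); rewrite !morphE kSK.
- by move: (congr1 phi e1'); rewrite !morphE.
- by move: (congr1 phi e2'); rewrite !morphE kSK.
- by move: (congr1 phi e1''); rewrite !morphE.
- by move: (congr1 phi e2''); rewrite !morphE kSK.
Qed.

(** Over [RF] this is convertible to [Dab]. *)
Definition Dgen a b : mould K :=
  madd (ari (sa K (2 * a + 1)%N) (ari (sa K (2 * b + 1)%N) (sa K (-1))))
       (mscale (2 * b)%:R (ari (slang 1 (sa K (2 * a + 1)%N))
                               (slang 2 (sa K (2 * b)%N)))).

Lemma slang1_sa_nil a : slang 1 (sa K (2 * a + 1)%N) [::] = 0.
Proof. by rewrite slang1_sa // adari_nil. Qed.

Lemma slang1_sa1 a u : slang 1 (sa K (2 * a + 1)%N) [:: u] = u ^+ (2 * a).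
Proof. by rewrite slang1_sa // adari1 // sa_exp_odd. Qed.

Lemma Dgen_nil a b : Dgen a b [::] = 0.
Proof. by rewrite /Dgen /madd /mscale !ari_nil ?slang1_sa_nil ?slang2_nil ?ari_nil // mulr0 addr0. Qed.

Lemma Dgen1 a b x : Dgen a b [:: x] = 0.
Proof. by rewrite /Dgen /madd /mscale !ari1 ?slang1_sa_nil ?slang2_nil ?ari_nil // mulr0 addr0. Qed.

Lemma Dgen2 a b x y : Dgen a b [:: x; y] = 0.
Proof.
rewrite /Dgen /madd /mscale ari2 ?ari_nil // [ari (slang _ _) _ _]ari2 ?slang1_sa_nil ?slang2_nil //.
by rewrite !ari1 // !slang2_1; ring.
Qed.

(** The right factors of both brackets start in length 2, so only the length-one parts of the left
    factors enter. These coincide, and the brackets combine into one with [Dkernel b]. *)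
Lemma Dgen3 a b x y z : Dgen a b [:: x; y; z] =
  (x + y + z) ^+ (2 * a) * (Dkernel b [:: x; y] - Dkernel b [:: y; z])
  + x ^+ (2 * a) * Dkernel b [:: y; z]
  - (Dkernel b [:: x + y; z] * (x ^+ (2 * a) - y ^+ (2 * a))
     + Dkernel b [:: x; y + z] * (y ^+ (2 * a) - z ^+ (2 * a))
     + Dkernel b [:: x; y] * z ^+ (2 * a)).
Proof.
rewrite /Dgen /Dkernel /madd /mscale ari3 ?ari_nil //.
rewrite [ari (slang _ _) _ _]ari3 ?slang1_sa_nil ?slang2_nil //.
rewrite !ari1 // !slang2_1 !slang1_sa1 !sa_exp_odd !(sa_size _ (w := [:: _; _])) //.
move: (_ ^+ _) (_ ^+ _) (_ ^+ _) (_ ^+ _) => p1 p2 p3 p4.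
move: (ari _ _ _) (ari _ _ _) (ari _ _ _) (ari _ _ _) => a1 a2 a3 a4.
move: (slang _ _ _) (slang _ _ _) (slang _ _ _) (slang _ _ _) (_%:R) => b1 b2 b3 b4 c.
ring.
Qed.

Lemma Dgen3_integral a b (p q r : R) : (0 < b)%N ->
    phi p != 0 -> phi q != 0 -> phi r != 0 -> phi p + phi q != 0 -> phi q + phi r != 0 ->
    phi p + phi q + phi r != 0 ->
  exists t, Dgen a b [:: phi p; phi q; phi r] = phi t.
Proof.
move=> b0 p0 q0 r0 pq0 qr0 pqr0.
have [t1 e1] := Dkernel_integral b0 p0 q0 pq0.
have [t2 e2] := Dkernel_integral b0 q0 r0 qr0.
(* Sums of letters are again images under [phi], so the same lemma covers the contracted words. *)
have [t3 e3] : exists t, Dkernel b [:: phi p + phi q; phi r] = phi t.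
  by rewrite -rmorphD; apply: Dkernel_integral; rewrite // rmorphD.
have [t4 e4] : exists t, Dkernel b [:: phi p; phi q + phi r] = phi t.
  by rewrite -rmorphD; apply: Dkernel_integral; rewrite // rmorphD // addrA.
exists ((p + q + r) ^+ (2 * a) * (t1 - t2) + p ^+ (2 * a) * t2
  - (t3 * (p ^+ (2 * a) - q ^+ (2 * a)) + t4 * (q ^+ (2 * a) - r ^+ (2 * a)) + t1 * r ^+ (2 * a))).
by rewrite Dgen3 e1 e2 e3 e4 !(rmorphB, rmorphD, rmorphM, rmorphXn).
Qed.

End Moulds.

(** * Specialisation to rational functions in three variables *)

Lemma varsE : exists i j k : 'I_3, [/\ vars 0 = [::], vars 1 = [:: var i],
  vars 2 = [:: var i; var j] & vars 3 = [:: var i; var j; var k]].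
Proof.
exists ord0, (lift ord0 ord0), (lift ord0 (lift ord0 ord0)).
rewrite /vars !enum_ordSl.
have -> : enum 'I_0 = [::] by apply: size0nil; rewrite size_enum_ord.
by [].
Qed.

Lemma RF_char0 n : n.+1%:R != 0 :> RF.
Proof.
rewrite -(rmorph_nat (@FracField.tofrac _)) tofrac_eq0.
by rewrite -(rmorph_nat (@mpolyC 3 rat)) mpolyC_eq0 Num.Theory.pnatr_eq0.
Qed.

(** The composite of [mpolyC] and [tofrac] is a ring morphism from [rat] to a field, so it agrees
    with [ratr]. *)
Lemma ratr_RF (r : rat) : ratr r = FracField.tofrac (r%:MP_[3]) :> RF.
Proof.
have ratr_id : r = ratr r by rewrite /ratr divq_num_den.
rewrite [in RHS]ratr_id.
exact/esym/(fmorph_rat (@FracField.tofrac {mpoly rat[3]} \o @mpolyC 3 rat)).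
Qed.

Lemma tofrac_neq0 (p : {mpoly rat[3]}) : meval (fun=> 1) p != 0 -> FracField.tofrac p != 0 :> RF.
Proof. by rewrite tofrac_eq0; apply: contraNneq => ->; rewrite meval0. Qed.

(** At the point with all coordinates 1 the sums take the values 1, 2 and 3, whichever indices occur
    and even if they repeat. *)
Lemma var_sums_neq0 (i j k : 'I_3) :
  [/\ var i != 0, var i + var j != 0 & var i + var j + var k != 0].
Proof.
split; rewrite /var -?tofracD; apply: tofrac_neq0; rewrite !(mevalD, mevalXU) //.
Qed.

Lemma xi_slang1 n : congr4 (xi n) (slang 1 (sa RF (2 * n + 1)%N)).
Proof.
have [i [j [k [v0 v1 v2 v3]]]] := varsE.
have [x0 xy0 xyz0] := var_sums_neq0 i j k; have [y0 yz0 _] := var_sums_neq0 j k k.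
have [z0 _ _] := var_sums_neq0 k k k.
rewrite (slang1_sa RF_char0).
case=> [|[|[|[|]]]] // _; rewrite ?v0 ?v1 ?v2 ?v3.
- by rewrite /xi xi'_nil // adari_nil.
- by rewrite /xi adari_pal1.
- by rewrite /xi (adari_pal2 RF_char0).
- by rewrite /xi (adari_pal3 RF_char0).
Qed.

Lemma Dab_ARI_ge3 a b : in_ARI_ge 3 (Dab a b).
Proof.
have [i [j [k [v0 v1 v2 _]]]] := varsE.
case=> [|[|[|]]] // _; rewrite ?v0 ?v1 ?v2.
- exact: (Dgen_nil RF_char0).
- exact: (Dgen1 RF_char0).
- exact: (Dgen2 RF_char0).
Qed.

Lemma Dab3_polynomial a b : (0 < b)%N ->
  exists p : {mpoly rat[3]}, Dab a b (vars 3) = FracField.tofrac p.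
Proof.
move=> b0; have [i [j [k [_ _ _ v3]]]] := varsE.
have [x0 xy0 xyz0] := var_sums_neq0 i j k; have [y0 yz0 _] := var_sums_neq0 j k k.
have [z0 _ _] := var_sums_neq0 k k k.
rewrite v3.
exact: (@Dgen3_integral RF RF_char0 _ (@FracField.tofrac {mpoly rat[3]}) a b _ _ _ b0 x0 y0 z0 xy0 yz0 xyz0).
Qed.

Lemma sigma_luma_diff n (sigc luma : mould RF) :
  congr4 sigc (sigma_formula n) -> congr4 luma (luma_formula n) ->
  congr4 (msub sigc luma) (diff_formula n).
Proof.
move=> hs hl m m3; rewrite /msub hs // hl // /sigma_formula /luma_formula /madd /msub.
rewrite xi_slang1 //; set x := slang _ _ _.
(* The leading terms, equal by [xi_slang1], cancel; the two sums are then compared term by term. *)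
rewrite opprB addrA addrAC [x + _]addrC addrK /diff_formula /msum.
rewrite -big_split /=; apply: eq_big_seq => a.
rewrite mem_iota => /andP [a1 an].
have na : (0 < n - a)%N by lia.
rewrite /mscale /Dab /madd /mscale [RHS]mulrDr; congr (_ + _); rewrite mulrA; congr (_ * _).
(* What remains is [12^-1 = (24 * b)^-1 * (2 * b)] with [b = n - a] positive, up to the common
   factor [bcoef n a]; it is pulled back to [rat]. *)
rewrite !ratr_RF -(rmorph_nat (@FracField.tofrac _)) -tofracM; congr (FracField.tofrac _).
rewrite -(rmorph_nat (@mpolyC 3 rat)) -mpolyCM; congr (mpolyC _ _).
rewrite !natrM; by field; rewrite Num.Theory.pnatr_eq0 -lt0n.
Qed.

Theorem theorem3p1 (n : nat) (hn : (1 <= n)%N) :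
  congr4 (xi n) (slang 1 (sa RF (2 * n + 1)%N))
  /\ (forall sigc luma : mould RF,
        congr4 sigc (sigma_formula n) ->
        congr4 luma (luma_formula n) ->
        congr4 (msub sigc luma) (diff_formula n))
  /\ (forall a b : nat, (1 <= a)%N -> (1 <= b)%N -> (a + b)%N = n ->
        in_ARI_ge 3 (Dab a b)
        /\ exists p : {mpoly rat[3]},
             Dab a b (vars 3) = FracField.tofrac p).
Proof.
split; first exact: xi_slang1.
split; first exact: sigma_luma_diff.
move=> a b _ b0 _; split; [exact: Dab_ARI_ge3 | exact: Dab3_polynomial].
Qed.
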